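(* Consider two deterministic $H$-MBQCs which differ only in their corresponding 2-cocycles, $\beta_\Psi$ versus $\beta'_\Psi$ (and hence possibly in their output functions $o$ and $o'$). If $[\beta_\Psi]=[\beta_\Psi']$ in $H^2(\mathcal{C}(E,E_0),\mathbb{Z}_2)$, then $[o]=[o']$.
   Context: Observables. Fix a finite-dimensional Hilbert space. $\mathcal{O}$ is a set of observables (Hermitian operators with eigenvalues $\pm1$ only) with $A\in\mathcal{O}\Leftrightarrow -A\in\mathcal{O}$. A resolution of an observable $X$ in $\mathcal{O}$ is a product $X=A_1(A_2(\cdots(A_{K-1}A_K)))$, $K\ge 1$, $A_i\in\mathcal{O}$, such that with $B_i:=\prod_{l=i+1}^K A_l$ (in this order) $[A_i,B_i]=0$ for $i=1,\dots,K-1$. $\mathcal{I}$ is the set of all observables having a resolution in $\mathcal{O}$. $E$ is the set of classes $\{A,-A\}$, $A\in\mathcal{I}$; for each $a\in E$ a representative $T_a\in\mathcal{I}$ is fixed. $E_{\mathcal{O}}:=\{a\in E: T_a\in\mathcal{O}\}$. For $a\in E_{\mathcal{O}}$, $b\in E$ with $[T_a,T_b]=0$, $a\oplus b\in E$ and $\beta(a,b)\in\mathbb{Z}_2$ are defined by $T_{a\oplus b}=(-1)^{\beta(a,b)}T_aT_b$. Chain complex (coefficients $\mathbb{Z}_2$). $C_1(E)$ is freely generated by $[a]$, $a\in E$; $C_2(E)$ is freely generated by the pairs $[a|b]$ for which $a\oplus b$ is defined; $\partial[a|b]=[a]+[b]+[a\oplus b]$. $\beta$ is regarded as a linear map $C_2(E)\to\mathbb{Z}_2$.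 For a function $c$ on $E$ (a 1-cochain), $dc(x):=c(\partial x)$. For $E_0\subset E$, $C_n(E,E_0):=C_n(E)/C_n(E_0)$, where $C_n(E_0)$ is spanned by the generators all of whose edges lie in $E_0$; $\partial_R$ is the induced boundary. Relative cochains $C^n(E,E_0)$ are the cochains on $C_n(E)$ vanishing on $C_n(E_0)$. Two relative 2-cocycles have the same class in $H^2(\mathcal{C}(E,E_0),\mathbb{Z}_2)$ iff they differ by $d\gamma$ for some $\gamma\in C^1(E,E_0)$, i.e. $\gamma:E\to\mathbb{Z}_2$ vanishing on $E_0$. Input group. $Q$ is a finite group acting on $E$ such that $qa\in E_{\mathcal{O}}$ for $a\in E_{\mathcal{O}}$, and $q(a\oplus b)=qa\oplus qb$ whenever $a\oplus b$ is defined; so $Q$ acts on the chain groups. A sequence of distinct edges $a_1,\dots,a_n\in E_{\mathcal{O}}$ is fixed, $\mathcal{E}_{\rm e}=\{a_1,\dots,a_n\}$, such that $a_{\rm e}:=a_1\oplus(a_2\oplus\cdots\oplus(a_{n-1}\oplus a_n))$ is defined. $E_0:=\{qa_{\rm e}: q\in Q\}$, and $\mathcal{E}_{\rm e}\cap E_0=\emptyset$. With $b_i:=a_{i+1}\oplus(\cdots\oplus a_n)$ (so $b_{n-1}=a_n$), $f_{\rm e}$ is the image of $\sum_{i=1}^{n-1}[a_i|b_i]$ in $C_2(E,E_0)$; $\partial_R f_{\rm e}=\sum_i a_i$. Deterministic $H$-MBQC. On input $q\in Q$ the observables $T_{qa_1},\dots,T_{qa_n}$ are measured (projectively, sequentially)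 on the resource state $|\Psi\rangle$, giving outcomes $s(qa_i)\in\mathbb{Z}_2$ (measured eigenvalue $(-1)^{s(qa_i)}$), and the output is $o(q)=\sum_i s(qa_i)\bmod 2$. Deterministic means that $T_a|\Psi\rangle=(-1)^{s_\Psi(a)}|\Psi\rangle$ for all $a\in E_0$, for some $s_\Psi:E_0\to\mathbb{Z}_2$; then $o(q)$ is uniquely determined, $\prod_{i}T_{qa_i}|\Psi\rangle=(-1)^{o(q)}|\Psi\rangle$ (product in the order $1,\dots,n$). Let $\overline{s}_\Psi:E\to\mathbb{Z}_2$ be the extension of $s_\Psi$ by zero on $E\setminus E_0$; $\beta_\Psi:=\beta+d\overline{s}_\Psi$, a 2-cocycle vanishing on $C_2(E_0)$, hence a relative 2-cocycle. ''Differ only in their 2-cocycles'' means that the two computations share the same $E$, $E_{\mathcal{O}}$, $\oplus$ (hence the same chain complexes), the same $Q$ and its action, the same sequence $a_1,\dots,a_n$, hence the same $E_0$ and $f_{\rm e}$. Equivalence of output functions. A change of gauge $T_a\mapsto(-1)^{\gamma(a)}T_a$ changes $\beta_\Psi$ to $\beta_\Psi+d\gamma|_{E\setminus E_0}$ (restriction of $\gamma$ to $E\setminus E_0$, extended by zero) and correspondingly the output function. $[o]$ is the class of output functions obtained from $o$ by change of gauge: $[o]=\{o+\gamma(\,\cdot\,\partial_R f_{\rm e}): \gamma:E\setminus E_0\to\mathbb{Z}_2\}$, where $\gamma(\,\cdot\,\partial_R f_{\rm e})$ is the function $q\mapsto\gamma(q\,\partial_Rf_{\rm e})=\sum_i\gamma(qa_i)$.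 *)

(* Defs.v *)
From HB Require Import structures.
From mathcomp Require Import all_boot all_order all_fingroup all_algebra.
From mathcomp Require Import mathcomp_extra boolp classical_sets functions.
From mathcomp Require Import reals.
From mathcomp Require Import complex.
From mathcomp Require Import freeg.

Set Implicit Arguments.
Unset Strict Implicit.
Unset Printing Implicit Defensive.

Import Order.TTheory GRing.Theory Num.Theory.
Local Open Scope classical_set_scope.
Local Open Scope ring_scope.

Section Observables.
Variables (R : realType) (d : nat).
Local Notation C := (R[i])%C.
Implicit Types (A X : 'M[C]_d) (O : set 'M[C]_d).

Definition observable X : Prop :=
  X \is hermsymmx /\ (forall l : C, eigenvalue X l -> l = 1 \/ l = -1).

(* [:: A_1; ...; A_K] is a resolution of X in O; the tail of the sequence
   after A_i multiplies to B_i. *)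
Definition resolution O (As : seq 'M[C]_d) X : Prop :=
  [/\ As != [::],
      forall A, A \in As -> O A,
      forall i, (i.+1 < size As)%N ->
        comm_mx (nth 0 As i) (\prod_(A <- drop i.+1 As) A)
    & X = \prod_(A <- As) A].

Definition inferable O : set 'M[C]_d :=
  [set X | observable X /\ exists As, resolution O As X].

Definition classes O : set (set 'M[C]_d) :=
  [set [set A; - A] | A in inferable O].

Definition sgn (s : 'Z_2) : C := (-1) ^+ (s : nat).

(* For X with X ^ 2 = 1 this is the orthogonal projector onto the eigenspace
   of X for the eigenvalue (-1)^s. *)
Definition eigenproj X (s : 'Z_2) : 'M[C]_d := 2^-1 *: (1%:M + sgn s *: X).

End Observables.

(* Throughout, [osum : E -> E -> option E] is the partial operation (+) on the
   edges, [None] meaning "undefined". *)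
Section ChainComplex.
Variables (E : choiceType) (osum : E -> E -> option E).

(* generators [a|b] of C_2 *)
Definition face := {p : E * E | osum p.1 p.2 != None}.

Definition fst_edge (x : face) : E := (val x).1.
Definition snd_edge (x : face) : E := (val x).2.
(* the default value is never used *)
Definition sum_edge (x : face) : E :=
  odflt (fst_edge x) (osum (fst_edge x) (snd_edge x)).

Definition C1 := {freeg E / 'Z_2}.
Definition C2 := {freeg face / 'Z_2}.

(* linear extension to chains of a function on the generators *)
Definition ev (K : choiceType) (c : K -> 'Z_2) : {freeg K / 'Z_2} -> 'Z_2 :=
  fglift (c : K -> ('Z_2)^o).

Definition bdry : C2 -> C1 :=
  fglift (fun x : face =>
    (<< fst_edge x >> + << snd_edge x >> + << sum_edge x >> : C1)).

Definition cobdry (c : E -> 'Z_2) : C2 -> 'Z_2 := fun x => ev c (bdry x).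

(* C^1(E, E0) *)
Definition rel_cochain1 (E0 : set E) (c : E -> 'Z_2) : Prop :=
  forall a, E0 a -> c a = 0.

(* The class in H^2(C(E, E0), Z_2) of a relative 2-cocycle, as a coset. *)
Definition rel_class (E0 : set E) (z : C2 -> 'Z_2) : set (C2 -> 'Z_2) :=
  [set z' | exists c, rel_cochain1 E0 c /\ z' = (fun x => z x + cobdry c x)].

(* a_1 (+) (a_2 (+) ... (a_(n-1) (+) a_n)); undefined for n = 0 *)
Fixpoint osums (s : seq E) : option E :=
  match s with
  | [::] => None
  | [:: a] => Some a
  | a :: s' => obind (osum a) (osums s')
  end.

(* the generator [a|b] as a chain; 0 if [a (+) b] is undefined *)
Definition face_chain (a b : E) : C2 :=
  if @insub _ _ face (a, b) is Some x then << x >> else 0.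

(* \sum_(i < n) [a_i | b_i]  with  b_i = a_(i+1) (+) (... (+) a_n) *)
Fixpoint osums_chain (s : seq E) : C2 :=
  if s is a :: s' then
    (if osums s' is Some b then face_chain a b else 0) + osums_chain s'
  else 0.

End ChainComplex.

(* The data shared by computations that differ only in their 2-cocycles.
   [osum a b = Some c] reads "a (+) b is defined and equal to c", and
   [qmul q a] is the (left) action of q on the edge a. *)
Record mbqc_frame (E : choiceType) (Q : finGroupType) := MbqcFrame {
  EO : set E;
  osum : E -> E -> option E;
  qmul : Q -> E -> E;
  qmul1 : forall a, qmul 1%g a = a;
  qmulM : forall q r a, qmul (q * r)%g a = qmul q (qmul r a);
  qmul_EO : forall q a, EO a -> EO (qmul q a);
  qmul_osum : forall q a b c,
    osum a b = Some c -> osum (qmul q a) (qmul q b) = Some (qmul q c);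
  edges : seq E;
  edges_uniq : uniq edges;
  edges_EO : forall a, a \in edges -> EO a;
  ae : E;
  aeE : osums osum edges = Some ae;
  edges_ae : forall a q, a \in edges -> a <> qmul q ae
}.

Section Frame.
Variables (E : choiceType) (Q : finGroupType) (F : mbqc_frame E Q).

Definition E0 : set E := [set qmul F q (ae F) | q in [set: Q]].

Definition qmul_C1 (q : Q) : C1 E -> C1 E :=
  fglift (fun a : E => (<< qmul F q a >> : C1 E)).

(* A representative in C_2(E) of the relative chain f_e. A relative cochain
   vanishes on C_n(E0), so that it may be evaluated on representatives. *)
Definition fe : C2 (osum F) := osums_chain (osum F) (edges F).

Definition output_class (o : Q -> 'Z_2) : set (Q -> 'Z_2) :=
  [set o' | exists c, rel_cochain1 E0 c /\
                      o' = (fun q => o q + ev c (qmul_C1 q (bdry fe)))].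

End Frame.

(* A computation on the frame F. The bijection [a |-> {Trep a, - Trep a}] identifies
   the abstract edges with the classes of inferable observables, so that
   computations with different observables can share the same edges. *)
Record mbqc (R : realType) (E : choiceType) (Q : finGroupType)
    (F : mbqc_frame E Q) := Mbqc {
  hdim : nat;
  obs : set 'M[(R[i])%C]_hdim;
  obs_observable : forall A, obs A -> observable A;
  obsN : forall A, obs A <-> obs (- A);
  Trep : E -> 'M[(R[i])%C]_hdim;
  Trep_bij : set_bij [set: E] (classes obs) (fun a => [set Trep a; - Trep a]);
  EO_obs : forall a, EO F a <-> obs (Trep a);
  osumP : forall a b c, osum F a b = Some c <->
    [/\ EO F a, comm_mx (Trep a) (Trep b)
      & [set Trep c; - Trep c] (Trep a *m Trep b)];
  beta : face (osum F) -> 'Z_2;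
  betaE : forall x, Trep (sum_edge x) =
    sgn R (beta x) *: (Trep (fst_edge x) *m Trep (snd_edge x));
  psi : 'cV[(R[i])%C]_hdim;
  psi_unit : \sum_i `|psi i 0| ^+ 2 = 1
}.

Section Computation.
Variables (R : realType) (E : choiceType) (Q : finGroupType).
Variables (F : mbqc_frame E Q) (M : mbqc R F).

(* The unnormalized state after measuring the observables T_(q a_1), ...,
   T_(q a_n) in this order, with outcome s b for each measured edge b; its
   squared norm is the probability of these outcomes. *)
Definition post_state (q : Q) (s : E -> 'Z_2) : 'cV[(R[i])%C]_(hdim M) :=
  foldl (fun v b => eigenproj (Trep M b) (s b) *m v) (psi M)
        [seq qmul F q a | a <- edges F].

(* On input q, every run (of nonzero probability) outputs o q. *)
Definition outputs (o : Q -> 'Z_2) : Prop :=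
  forall q s, post_state q s != 0 -> o q = \sum_(a <- edges F) s (qmul F q a).

(* Only the values of s on E0 matter. *)
Definition deterministic (s : E -> 'Z_2) : Prop :=
  forall a, E0 F a -> Trep M a *m psi M = sgn R (s a) *: psi M.

Definition beta_psi (s : E -> 'Z_2) : C2 (osum F) -> 'Z_2 :=
  fun x => ev (beta M) x + cobdry (patch (fun=> 0) (E0 F) s) x.

End Computation.

(* Main.v *)
(** For a sequence [a_1, ..., a_n] put [b_i := a_(i+1) (+) ... (+) a_n]. Each
    [T_(a_i)] commutes with [T_(b_i)] and [T_(a_i) T_(b_i)] is, up to the sign
    given by [beta(a_i, b_i)], equal to [T_(b_(i-1))]. Hence after measuring
    [a_1, ..., a_i] on an eigenvector of [T_(b_0)] the state is an eigenvector
    of [T_(b_i)], and the outcomes add up to the eigenvalue of [T_(b_0)] plus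
    [sum_i beta(a_i, b_i)]. For the edges [q a_i] this reads
    [o(q) = beta_psi(q f_e)], so that adding [d c] to [beta_psi] adds
    [c(q (bdry f_e))] to [o(q)]. *)
Require Import Defs.
From mathcomp Require Import all_boot all_order all_fingroup all_algebra.
From mathcomp Require Import boolp classical_sets reals.
From mathcomp Require Import functions complex freeg.

Set Implicit Arguments.
Unset Strict Implicit.
Unset Printing Implicit Defensive.

Import GRing.Theory Num.Theory.
Local Open Scope ring_scope.

Lemma Z2_addxx (x : 'Z_2) : x + x = 0.
Proof. by case: x => [[|[|//]] ?]; apply/val_inj. Qed.

(** * Linear extension on free ['Z_2]-modules *)

Section FreeModules.
Variables (K : choiceType).
Implicit Types (x y : {freeg K / 'Z_2}).

Lemma fgliftB (V : lmodType 'Z_2) (f : K -> V) x y :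
  fglift f (x - y) = fglift f x - fglift f y.
Proof. exact: lift_is_additive. Qed.

Lemma fglift0 (V : lmodType 'Z_2) (f : K -> V) : fglift f 0 = 0.
Proof. by rewrite -(subrr 0) fgliftB subrr. Qed.

Lemma fgliftD (V : lmodType 'Z_2) (f : K -> V) x y :
  fglift f (x + y) = fglift f x + fglift f y.
Proof. by rewrite -{1}(opprK y) -(sub0r y) !fgliftB fglift0 sub0r opprK. Qed.

Lemma fglift_sum (V : lmodType 'Z_2) (f : K -> V) (I : Type) (r : seq I)
    (g : I -> {freeg K / 'Z_2}) :
  fglift f (\sum_(i <- r) g i) = \sum_(i <- r) fglift f (g i).
Proof. by apply: (big_morph (fglift f)); [exact: fgliftD|exact: fglift0]. Qed.

Lemma freeg_addxx x : x + x = 0.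
Proof. by apply/eqP/freeg_eqP => k; rewrite coeffD coeff0 Z2_addxx. Qed.

Lemma evD (c : K -> 'Z_2) x y : ev c (x + y) = ev c x + ev c y.
Proof. exact: (@fgliftD ('Z_2)^o). Qed.

Lemma evU (c : K -> 'Z_2) k : ev c << k >> = c k.
Proof. by rewrite /ev liftU scale1r. Qed.

Lemma ev0 x : ev (fun=> 0) x = 0.
Proof.
elim/freeg_ind_dom0: x => [|k a x _ _ IH]; first exact: (@fglift0 ('Z_2)^o).
by rewrite evD IH addr0 /ev liftU scaler0.
Qed.

End FreeModules.

(** * Iterated sums of edges and their chains *)

Section Chains.
Variables (E : choiceType) (osum : E -> E -> option E).
Implicit Types (a b e : E) (t : seq E).

(** The second case carries the proof [h] that [[a|b]] is a face, so that inductions meet an actual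
    generator and not the default values of [face_chain] and [sum_edge]. *)
Lemma osums_cons a t e : osums osum (a :: t) = Some e ->
  t = [::] /\ e = a \/
  exists b (h : osum a b != None),
    [/\ osums osum t = Some b, osum a b = Some e,
        osums_chain osum (a :: t) =
          << (exist _ (a, b) h : face osum) >> + osums_chain osum t
      & sum_edge (exist _ (a, b) h : face osum) = e].
Proof.
case: t => [[<-]|b0 t]; first by left.
rewrite [LHS](_ : _ = obind (osum a) (osums osum (b0 :: t))) //.
case tb : (osums osum (b0 :: t)) => [b|//] /= abe; right.
have h : osum a b != None by rewrite abe.
exists b, h; split=> //; last by rewrite /sum_edge /fst_edge /snd_edge /= abe.
rewrite [LHS](_ : _ = (if osums osum (b0 :: t) is Some b then face_chain osum a b
  else 0) + osums_chain osum (b0 :: t)) // tb.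
by rewrite /face_chain insubT.
Qed.

(** The boundary telescopes: [[a_i|b_i]] contributes [a_i + b_i + b_(i-1)], and modulo 2 only the
    [a_i] (with [a_n = b_(n-1)]) and the total [b_0] survive. For one edge the chain is 0 and the
    right-hand side is twice that edge. *)
Lemma bdry_osums_chain t e : osums osum t = Some e ->
  bdry (osums_chain osum t) = \sum_(a <- t) << a >> + << e >>.
Proof.
elim: t e => [//|a t IH] e /osums_cons[[-> ->]|[b [h [tb _ -> abe]]]].
  by rewrite /= addr0 /bdry fglift0 big_seq1 freeg_addxx.
rewrite /bdry fgliftD [X in _ + X](IH _ tb) liftU scale1r abe big_cons.
by rewrite [X in X + _]addrAC addrACA freeg_addxx addr0 addrAC.
Qed.

End Chains.

Section Signs.
Variable R : realType.

Lemma sgnD (x y : 'Z_2) : sgn R (x + y) = sgn R x * sgn R y.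
Proof.
by case: x y => [[|[|//]] ?] [[|[|//]] ?];
  rewrite /sgn /= ?expr0 ?expr1 ?mulr1 ?mul1r ?mulrNN ?mulr1.
Qed.

Lemma sgn_inj : injective (sgn R).
Proof.
have N : (-1 : R[i]) != 1 by rewrite eqNr oner_eq0.
case=> [[|[|//]] ?] [[|[|//]] ?] H; apply/val_inj => //=; move: H;
  by rewrite /sgn /= expr0 expr1 => /eqP; rewrite ?[1 == _]eq_sym (negPf N).
Qed.

Lemma sgnK (x : 'Z_2) : sgn R x * sgn R x = 1.
Proof. by rewrite -sgnD Z2_addxx. Qed.

End Signs.

(** * Hermitian involutions and nonzero vectors *)

Section Matrices.
Variables (C : numClosedFieldType) (d : nat).
Implicit Types (X : 'M[C]_d) (v : 'cV[C]_d).

(** By the spectral theorem [X] is diagonalisable, and each diagonal entry is an eigenvalue, hence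
    squares to 1. *)
Lemma hermsymmx_sqr X : X \is hermsymmx ->
  (forall l, eigenvalue X l -> l = 1 \/ l = -1) -> X *m X = 1%:M.
Proof.
move=> /hermitian_normalmx/orthomx_spectralP; set P := spectralmx X.
set D := spectral_diag X => XE eigX.
have Pu : P \in unitmx by exact: spectral_unit.
have PX : P *m X = diag_mx D *m P by rewrite XE !mulmxA mulmxV // mul1mx.
have DD j : D 0 j * D 0 j = 1.
  suff /eigX[->|->] : eigenvalue X (D 0 j) by rewrite ?mulrNN mulr1.
  apply/eigenvalueP; exists (row j P).
    by rewrite -row_mul PX row_mul row_diag_mx -scalemxAl -rowE.
  (* An invertible [P] has no zero row, so [row j P] is an eigenvector. *)
  apply: contraTneq Pu => Pj0; rewrite -row_free_unit.
  apply/negP => /row_freeP[Q /(congr1 (row j))]; rewrite row_mul Pj0 mul0mx.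
  by move=> /rowP/(_ j)/eqP; rewrite !mxE eqxx eq_sym oner_eq0.
rewrite XE -!mulmxA [P *m _]mulmxA mulmxV // mul1mx (mulmxA (diag_mx D)).
rewrite mulmx_diag.
have -> : \row_j (D 0 j * D 0 j) = const_mx 1.
  by apply/rowP => j; rewrite !mxE DD.
by rewrite diag_const_mx mul1mx mulVmx.
Qed.

Lemma mulmx_neq0_split X Y v : X + Y = 1%:M -> v != 0 ->
  X *m v != 0 \/ Y *m v != 0.
Proof.
move=> XY v0; apply/orP; rewrite -negb_and; apply: contra v0.
by case/andP=> /eqP X0 /eqP Y0; rewrite -[v]mul1mx -XY mulmxDl X0 Y0 addr0.
Qed.

Lemma scalemx_inj v (x y : C) : v != 0 -> x *: v = y *: v -> x = y.
Proof.
move=> v0 /eqP; rewrite -subr_eq0 -scalerBl scaler_eq0 (negPf v0) orbF.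
by rewrite subr_eq0 => /eqP.
Qed.

Lemma unit_vector_neq0 v : \sum_i `|v i 0| ^+ 2 = 1 -> v != 0.
Proof.
apply: contra_eq_neq => ->; rewrite big1 => [|i _].
  by rewrite eq_sym oner_eq0.
by rewrite mxE normr0 expr0n.
Qed.

End Matrices.

(** * Sequential choice of outcomes, and eigenprojectors *)

Lemma eq_in_foldl (A : eqType) (B : Type) (f g : B -> A -> B) t v :
  {in t, forall a, f^~ a =1 g^~ a} -> foldl f v t = foldl g v t.
Proof.
elim: t v => [//|a t IH] v fg /=.
by rewrite fg ?mem_head // IH // => b bt; apply: fg; rewrite inE bt orbT.
Qed.

(** The choice [g] depends on the entry, not on its position; by [uniq t] the value set at the head
    is never consulted in the tail. *)
Lemma foldl_choice (A : eqType) (X B : Type) (x0 : X) (P : B -> Prop)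
    (f : B -> A -> X -> B) t v :
  (forall a u, P u -> exists x, P (f u a x)) -> uniq t -> P v ->
  exists g : A -> X, P (foldl (fun u a => f u a (g a)) v t).
Proof.
move=> Pf; elim: t v => [|a t IH] v /=; first by exists (fun=> x0).
case/andP=> nat ut /(Pf a)[x /(IH _ ut)[g Pg]].
exists (fun b => if b == a then x else g b); rewrite eqxx.
rewrite (eq_in_foldl (g := fun u b => f u b (g b))) // => b bt u.
by have [ba|//] := eqVneq b a; rewrite -ba bt in nat.
Qed.

Section Measurement.
Variables (R : realType) (d : nat).
Implicit Types (X : 'M[R[i]]_d) (v : 'cV[R[i]]_d).

Lemma observable_sqr X : observable X -> X *m X = 1%:M.
Proof. by case; exact: hermsymmx_sqr. Qed.

Lemma eigenprojK X x v : observable X ->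
  X *m (eigenproj X x *m v) = sgn R x *: (eigenproj X x *m v).
Proof.
move=> /observable_sqr XX; rewrite mulmxA scalemxAl; congr (_ *m _).
rewrite /eigenproj -scalemxAr scalerA mulrC -scalerA; congr (_ *: _).
by rewrite mulmxDr mulmx1 -scalemxAr XX scalerDr scalerA sgnK scale1r addrC.
Qed.

Lemma eigenproj_comm X Y x : comm_mx Y X ->
  comm_mx Y (eigenproj X x).
Proof.
move=> YX; rewrite /comm_mx /eigenproj -scalemxAr -scalemxAl mulmxDr mulmxDl.
by rewrite mulmx1 mul1mx -scalemxAr -scalemxAl YX.
Qed.

Lemma eigenproj_sum X : eigenproj X 0 + eigenproj X 1 = 1%:M.
Proof.
rewrite /eigenproj -scalerDr /sgn /= expr0 expr1 scale1r scaleN1r.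
rewrite addrACA subrr addr0 -[X in X + _]scale1r -[X in _ + X]scale1r -scalerDl.
by rewrite scalerA mulVf ?scale1r // pnatr_eq0.
Qed.

Lemma eigenproj_neq0 X v : v != 0 -> exists x, eigenproj X x *m v != 0.
Proof.
by move=> /(mulmx_neq0_split (eigenproj_sum X))[]; [exists 0|exists 1].
Qed.

End Measurement.

(** * Outcomes of a sequence of measurements *)

Section Computation.
Variables (R : realType) (E : choiceType) (Q : finGroupType).
Variables (F : mbqc_frame E Q) (M : mbqc R F).
Local Notation T := (Trep M).
Local Notation measure out := (foldl (fun v b => eigenproj (T b) (out b) *m v)).
Implicit Types (t : seq E) (v : 'cV[R[i]]_(hdim M)) (out : E -> 'Z_2).

(** The two eigenprojectors of a measurement sum to the identity, so they cannot both annihilate the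
    state. This supplies a run to which [outputs] applies. *)
Lemma measure_neq0 t v : uniq t -> v != 0 -> exists out, measure out v t != 0.
Proof.
apply: (foldl_choice 0 (P := fun u => u != 0)
  (f := fun u b x => eigenproj (T b) x *m u)) => a u.
exact: eigenproj_neq0.
Qed.

Lemma measure_outcomes t e v x out :
  {in t, forall a, EO F a} -> osums (osum F) t = Some e ->
  T e *m v = sgn R x *: v -> measure out v t != 0 ->
  \sum_(a <- t) out a = x + ev (beta M) (osums_chain (osum F) t).
Proof.
elim: t e v x => [//|a t IH] e v x tO.
have aobs : observable (T a).
  by apply/(@obs_observable _ _ _ _ M)/EO_obs/tO; rewrite mem_head.
have tO' : {in t, forall b, EO F b} by move=> b bt; apply: tO; rewrite inE bt orbT.
case/osums_cons=> [[-> ->]|[b [h [tb abe -> se]]]] /=.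
  (* The projected vector is nonzero and an eigenvector of [T a] for both signs, which therefore
     agree. *)
  move=> Tv w0; rewrite big_seq1 addr0 /ev fglift0 addr0; apply: (@sgn_inj R).
  have := eigenprojK (out a) v aobs.
  rewrite mulmxA (eigenproj_comm (out a) (erefl (T a *m T a))) -mulmxA Tv.
  by rewrite -scalemxAr => /esym; exact: scalemx_inj.
move=> Tv; set w := eigenproj (T a) (out a) *m v => w0.
have [_ ab _] := (osumP M a b e).1 abe.
set f : face _ := exist _ (a, b) h; have Te := betaE M f.
rewrite se in Te.
have Tbw : T b *m w = sgn R (out a + beta M f + x) *: w.
  (* [T e] is a multiple of [T a *m T b], hence commutes with [T a], and its eigenvalue survives the
     measurement of [a]. *)
  have ea : comm_mx (T e) (T a).
    rewrite Te /comm_mx -scalemxAl -scalemxAr /fst_edge /snd_edge /=.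
    by rewrite -mulmxA -ab.
  have Tew : T e *m w = sgn R x *: w.
    by rewrite /w mulmxA (eigenproj_comm (out a) ea) -mulmxA Tv -scalemxAr.
  have Taw : T a *m w = sgn R (out a) *: w by exact: eigenprojK.
  have Tbaw : T b *m w = sgn R (out a) *: (T b *m (T a *m w)).
    by rewrite Taw -scalemxAr scalerA sgnK scale1r.
  have Tabw : T a *m T b *m w = sgn R (beta M f) *: (T e *m w).
    by rewrite Te -scalemxAl scalerA sgnK scale1r.
  by rewrite Tbaw mulmxA -ab Tabw Tew !scalerA !sgnD.
(* [out a] occurs once as an outcome and once in the eigenvalue of [T b], and cancels modulo 2. *)
rewrite big_cons (IH _ _ _ tO' tb Tbw w0) evD evU.
rewrite !addrA Z2_addxx add0r; congr (_ + _); exact: addrC.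
Qed.

End Computation.

(** * Translation by the input, and the output function *)

Section Frame.
Variables (E : choiceType) (Q : finGroupType) (F : mbqc_frame E Q).
Implicit Types (q : Q) (a : E) (t : seq E) (c : E -> 'Z_2).

Lemma qmulK q : cancel (qmul F q) (qmul F q^-1%g).
Proof. by move=> a; rewrite -qmulM mulVg qmul1. Qed.

Lemma osums_qmul q t e : osums (osum F) t = Some e ->
  osums (osum F) (map (qmul F q) t) = Some (qmul F q e).
Proof.
elim: t e => [//|a t IH] e /osums_cons[[-> ->] //|[b [h [tb abe _ _]]]].
case: t tb IH => [//|a' t] tb /(_ _ tb) IH.
rewrite [LHS](_ : _ = obind (osum F (qmul F q a))
  (osums (osum F) (map (qmul F q) (a' :: t)))) // IH.
exact: qmul_osum.
Qed.

Lemma edges_notin_E0 q a : a \in edges F -> qmul F q a \notin E0 F.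
Proof.
move=> aF; apply/negP; rewrite inE => -[r _ /(congr1 (qmul F q^-1%g))].
rewrite qmulK -qmulM => /esym; exact: edges_ae.
Qed.

Lemma ev_qmul_bdry_fe c q : rel_cochain1 (E0 F) c ->
  ev c (qmul_C1 F q (bdry (fe F))) = \sum_(a <- edges F) c (qmul F q a).
Proof.
move=> c0; rewrite (bdry_osums_chain (aeE F)) /qmul_C1 fgliftD evD fglift_sum.
rewrite [X in _ + ev c X]liftU scale1r evU c0; last by exists q.
rewrite addr0 /ev fglift_sum; apply: eq_bigr => a _.
by rewrite [X in fglift _ X]liftU scale1r; exact: evU.
Qed.

(** The chain of the translated edges represents [q f_e]. Here [c] need not vanish on [E0], since
    the lemma also serves for the extension of [s] by zero. *)
Lemma cobdry_qfe c q :
  cobdry c (osums_chain (osum F) (map (qmul F q) (edges F))) =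
  \sum_(a <- edges F) c (qmul F q a) + c (qmul F q (ae F)).
Proof.
rewrite /cobdry (bdry_osums_chain (osums_qmul q (aeE F))) evD evU.
congr (_ + _); rewrite big_map /ev fglift_sum.
by apply: eq_bigr => a _; exact: evU.
Qed.

Lemma output_beta_psi (R : realType) (M : mbqc R F) (s : E -> 'Z_2) o q :
  deterministic M s -> outputs M o ->
  o q = beta_psi M s (osums_chain (osum F) (map (qmul F q) (edges F))).
Proof.
move=> det_M out_M.
have psi0 := unit_vector_neq0 (psi_unit M).
have uq : uniq (map (qmul F q) (edges F)).
  by rewrite map_inj_uniq ?edges_uniq //; exact: can_inj (qmulK q).
have [out nz] := measure_neq0 uq psi0.
rewrite (out_M q out nz) -(big_map (qmul F q) xpredT out).
have E0ae : E0 F (qmul F q (ae F)) by exists q.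
rewrite (measure_outcomes _ (osums_qmul q (aeE F)) (det_M _ E0ae) nz); last first.
  by move=> _ /mapP[a aF ->]; apply/qmul_EO/edges_EO.
(* The edges [q a_i] lie outside [E0], so the extended [s] contributes only its value at [q ae]. *)
rewrite /beta_psi cobdry_qfe big_seq big1 => [|a aF]; last first.
  by rewrite /patch (negPf (edges_notin_E0 q aF)).
by rewrite add0r /patch mem_set // addrC.
Qed.

End Frame.

Theorem corollary1 (R : realType) (E : choiceType) (Q : finGroupType)
  (F : mbqc_frame E Q) (M M' : mbqc R F) (s s' : E -> 'Z_2) (o o' : Q -> 'Z_2)
  (det_M : deterministic M s) (det_M' : deterministic M' s')
  (out_M : outputs M o) (out_M' : outputs M' o') :
  rel_class (E0 F) (beta_psi M s) = rel_class (E0 F) (beta_psi M' s') ->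
  output_class F o = output_class F o'.
Proof.
move=> eq_beta.
(* [beta_psi M' s'] lies in its own class, by the zero cochain. *)
have [c [c0 cE]] : rel_class (E0 F) (beta_psi M s) (beta_psi M' s').
  rewrite eq_beta; exists (fun=> 0); split=> //.
  by apply: funext => x; rewrite /cobdry ev0 addr0.
have o'E q : o' q = o q + \sum_(a <- edges F) c (qmul F q a).
  rewrite (output_beta_psi q det_M out_M) (output_beta_psi q det_M' out_M') cE.
  by rewrite cobdry_qfe [c (qmul F q (ae F))]c0 ?addr0 //; exists q.
(* As [c = - c], the witness [c + g] serves both inclusions. *)
apply/seteqP; split=> _ [g [g0 ->]];
  (exists (fun a => c a + g a); split=> [a aE0|]; first by rewrite c0 // g0 // addr0);
  apply: funext => q; rewrite !ev_qmul_bdry_fe // => [|a aE0];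
  rewrite ?c0 ?g0 ?addr0 // big_split /= o'E ?addrA //.
by rewrite -(addrA (o q)) Z2_addxx addr0.
Qed.
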